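(* Let $\mathcal{H}$ be a complex separable Hilbert space. For any unitary operator $U$ on $\mathcal{H}$, we have $\mathfrak{O}_c(U)\subseteq\mathfrak{O}(U^* )$.
   Context: A conjugation on a complex Hilbert space is an antilinear, isometric map $C$ with $C^2=I$. For a unitary operator $U$ on $\mathcal{H}$, the conjugate orbit is $\mathfrak{O}_c(U)=\{CUC: C \text{ a conjugation on } \mathcal{H}\}$ and the unitary orbit is $\mathfrak{O}(U)=\{VUV^*: V\text{ unitary on }\mathcal{H}\}$. *)

(* Defs.v *)
From HB Require Import structures.
From mathcomp Require Import all_boot all_order all_algebra complex.
From mathcomp Require Import all_classical all_reals all_analysis.

Set Implicit Arguments.
Unset Strict Implicit.
Unset Printing Implicit Defensive.

Import Order.TTheory GRing.Theory Num.Theory.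
Import numFieldNormedType.Exports.

Local Open Scope classical_set_scope.
Local Open Scope ring_scope.
Local Open Scope complex_scope.

(* The inner product is linear in its first argument and conjugate-linear in
   its second one. *)
HB.mixin Record CompleteNormedModule_isHilbert (R : realType) H
    & CompleteNormedModule R[i] H := {
  inner : {dot H for (@Num.conj R[i])} ;
  sqr_norm_inner : forall x : H, `|x| ^+ 2 = inner x x
}.

#[short(type="hilbertType")]
HB.structure Definition Hilbert (R : realType) :=
  {H of CompleteNormedModule R[i] H & CompleteNormedModule_isHilbert R H}.

Definition separable (T : topologicalType) : Prop :=
  exists2 S : set T, countable S & dense S.

Section Operators.
Context {R : realType} {H : hilbertType R}.
Implicit Types (A U V C : H -> H) (x y z : H).

(* A^* y is the vector z, unique if it exists, such that <A x, y> = <x, z> for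
   all x.  It exists for bounded linear A; otherwise [get] returns a default
   value. *)
Definition adjoint A : H -> H :=
  fun y => get [set z | forall x, inner (A x) y = inner x z].

Definition unitary U : Prop :=
  [/\ linear U, continuous U,
      adjoint U \o U = id & U \o adjoint U = id].

Definition antilinear C : Prop :=
  linear_for (@Num.conj R[i] \; *:%R) C.

Definition conjugation C : Prop :=
  [/\ antilinear C, forall x, `|C x| = `|x| & C \o C = id].

Definition conjugate_orbit U : set (H -> H) :=
  [set C \o U \o C | C in conjugation].

Definition unitary_orbit U : set (H -> H) :=
  [set V \o U \o adjoint V | V in unitary].

End Operators.

(* Main.v *)
(* Every unitary U admits a conjugation J with J U J = U^*; then, for any
   conjugation C, V = C J is unitary with V^* = J C, and C U C = V U^* V^*.

   To find J without the spectral theorem, observe that on a cyclic subspace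
   the antilinear map U^n w |-> U^-n w is isometric, because <U^n w, U^m w>
   depends on n - m only.  A Zorn argument on the graphs of partially defined
   symmetries glues such maps: a maximal graph is antilinear and closed, and
   its domain is the whole space, since otherwise the projection theorem gives
   a vector orthogonal to the domain, whose U-orbit can be added. *)
Require Import Defs.
From mathcomp Require Import all_boot all_order all_algebra complex.
From mathcomp Require Import all_classical all_reals all_analysis.
From mathcomp Require Import ring.

Local Open Scope classical_set_scope.

Import Order.TTheory GRing.Theory Num.Theory.
Import numFieldNormedType.Exports.
Local Open Scope ring_scope.
Local Open Scope complex_scope.

(** * Inner product identities, the Cauchy-Schwarz inequality and polarization *)

Section InnerProduct.
Context {R : realType} {H : hilbertType R}.
Implicit Types (x y z a b : H) (k : R[i]).

Local Notation "''[' x , y ]" := (@inner R H x y).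

Lemma innerC x y : '[x, y] = Num.conj '[y, x].
Proof. by rewrite (hermC inner x y) expr0 mul1r. Qed.
Lemma innerDl x y z : '[x + y, z] = '[x, z] + '[y, z].
Proof. exact: linearDl. Qed.
Lemma innerBl x y z : '[x - y, z] = '[x, z] - '[y, z].
Proof. exact: linearBl. Qed.
Lemma innerZl k x y : '[k *: x, y] = k * '[x, y].
Proof. exact: linearZl_LR. Qed.
Lemma innerDr x y z : '[x, y + z] = '[x, y] + '[x, z].
Proof. exact: linearDr. Qed.
Lemma innerBr x y z : '[x, y - z] = '[x, y] - '[x, z].
Proof. exact: linearBr. Qed.
Lemma innerZr k x y : '[x, k *: y] = Num.conj k * '[x, y].
Proof. exact: linearZr_LR. Qed.
Lemma inner0r x : '[x, 0] = 0.
Proof. exact: linear0r. Qed.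

Lemma inner_inj x y : (forall z, '[z, x] = '[z, y]) -> x = y.
Proof.
move=> xy; apply/eqP; rewrite -subr_eq0 -(dnorm_eq0 inner) innerBr xy.
by rewrite subrr.
Qed.

(** Pythagoras for the projection onto the line through [y]; it yields both Cauchy-Schwarz and the
    variational test for orthogonality. *)
Lemma sqr_norm_proj x y : y != 0 ->
  `|x - ('[x, y] / '[y, y]) *: y| ^+ 2 = `|x| ^+ 2 - `|'[x, y]| ^+ 2 / `|y| ^+ 2.
Proof.
move=> y0; have yy0 : '[y, y] != 0 by rewrite dnorm_eq0.
rewrite !sqr_norm_inner innerBl !innerBr !innerZr !innerZl.
rewrite fmorph_div /= -!innerC normCK -innerC.
by field.
Qed.

Lemma norm_inner_le x y : `|'[x, y]| <= `|x| * `|y|.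
Proof.
have [->|y0] := eqVneq y 0; first by rewrite inner0r normr0 mulr_ge0.
have y20 : 0 < `|y| ^+ 2 by rewrite exprn_gt0// normr_gt0.
rewrite -(ler_pXn2r (isT : (0 < 2)%N)) ?nnegrE ?mulr_ge0//.
by rewrite exprMn -ler_pdivrMr// -subr_ge0 -sqr_norm_proj.
Qed.

Lemma orthogonal_minimal x y : (forall k, `|x| <= `|x - k *: y|) -> '[x, y] = 0.
Proof.
move=> xy; have [->|y0] := eqVneq y 0; first exact: inner0r.
have y20 : 0 < `|y| ^+ 2 by rewrite exprn_gt0// normr_gt0.
have := xy ('[x, y] / '[y, y]).
rewrite -(ler_pXn2r (isT : (0 < 2)%N)) ?nnegrE// sqr_norm_proj//.
rewrite lerBrDr gerDl pmulr_lle0 ?invr_gt0// => h.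
have : `|'[x, y]| ^+ 2 == 0 by rewrite eq_le h exprn_ge0.
by rewrite expf_eq0 normr_eq0 => /eqP.
Qed.

(** Lets an identity pass to the limit in one slot on each side; Cauchy-Schwarz bounds both
    errors. *)
Lemma inner_approx x x' y y' :
  (forall e : R[i], 0 < e -> exists a b,
     [/\ '[a, y] = '[y', b], `|x - a| < e & `|x' - b| < e]) ->
  '[x, y] = '[y', x'].
Proof.
move=> h; apply/eqP; rewrite -subr_eq0 -normr_le0; apply/negPn/negP => D0.
have {D0}D0 : 0 < `|'[x, y] - '[y', x']|.
  by rewrite lt_neqAle normr_ge0 andbT eq_sym normr_eq0 -normr_le0.
set D := `|_| in D0.
(* The extra 1 keeps the divisor positive when [y] and [y'] vanish and makes the final bound on [D]
   strictly less than [D]. *)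
have p0 : 0 < `|y| + `|y'| + 1 by rewrite ltr_wpDl// addr_ge0.
have e0 : 0 < D / (`|y| + `|y'| + 1) by rewrite divr_gt0.
have [a [b [ab xa xb]]] := h _ e0.
have : D <= D / (`|y| + `|y'| + 1) * (`|y| + `|y'|).
  rewrite {1}/D (_ : _ - _ = '[x - a, y] - '[y', x' - b]); last first.
    by rewrite innerBl innerBr ab opprB addrA subrK.
  rewrite mulrDr (le_trans (ler_normB _ _))//.
  apply: lerD; apply: (le_trans (norm_inner_le _ _)).
    by rewrite ler_wpM2r// ltW.
  by rewrite mulrC ler_wpM2r// ltW.
rewrite mulrAC ler_pdivlMr// ler_pM2l// gerDl.
by rewrite lt_geF.
Qed.

Lemma parallelogram x y :
  `|x + y| ^+ 2 + `|x - y| ^+ 2 = 2 * (`|x| ^+ 2 + `|y| ^+ 2).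
Proof. rewrite !sqr_norm_inner !(innerBl, innerBr, innerDl, innerDr); ring. Qed.

Lemma cauchy_seq_lim (u : nat -> H) :
  (forall e : R[i], 0 < e -> exists N, forall n m, (N <= n)%N -> (N <= m)%N ->
     `|u n - u m| < e) ->
  exists l, forall e : R[i], 0 < e -> exists N, forall n, (N <= n)%N ->
    `|l - u n| < e.
Proof.
move=> h; have : cvg (u n @[n --> \oo]).
  apply/cauchy_cvgP/cauchy_exP => e e0; have [N hN] := h _ e0.
  exists (u N); exists N => // n /= Nn.
  rewrite -ball_normE /=; exact: hN.
move=> /cvg_ex[l /cvgrPdist_lt ul]; exists l => e e0.
by have [N _ hN] := ul _ e0; exists N => n Nn; exact: hN.
Qed.

Lemma conjugation_inner (C : H -> H) x y : conjugation C ->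
  '[C x, C y] = '[y, x].
Proof.
move=> [Cl Cn _].
have CD k : '[C (k *: x + y), C (k *: x + y)] = '[k *: x + y, k *: x + y].
  by rewrite -!sqr_norm_inner Cn.
have e2 z : '[C z, C z] = '[z, z] by rewrite -!sqr_norm_inner Cn.
have h k : Num.conj k * '[C x, C y] + k * '[C y, C x] =
           Num.conj k * '[y, x] + k * '[x, y].
  have := CD k; rewrite Cl /= !(innerDl, innerDr, innerZl, innerZr) !e2.
  rewrite !conjCK => E; apply/eqP; rewrite -subr_eq0; move/eqP: E.
  rewrite -subr_eq0 => /eqP <-; apply/eqP; ring.
(* Polarization: [k = 1] controls the sum of ['[C x, C y]] and ['[C y, C x]], [k = 'i] their
   difference. *)
have := h 1; rewrite rmorph1 !mul1r => h1.
have := h 'i%C; rewrite (_ : Num.conj 'i%C = - 'i%C) ?conjCi// => hi.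
have i20 : 'i%C * 2 != 0 :> R[i] by rewrite mulf_neq0 ?neq0Ci ?pnatr_eq0.
apply: (mulfI i20).
transitivity ('i%C * ('[C x, C y] + '[C y, C x])
              - (- 'i%C * '[C x, C y] + 'i%C * '[C y, C x])); first by ring.
rewrite h1 hi; ring.
Qed.

(** * Minimizing sequences for the distance to a set *)

Lemma natSinv_lt (e : R[i]) : 0 < e ->
  exists N, forall n, (N <= n)%N -> n.+1%:R^-1 < e.
Proof.
move=> e0; have er : (complex.Re e)%:C = e by rewrite RRe_real// gtr0_real.
have re0 : 0 < complex.Re e by rewrite -ltcR er.
have [N _ hN] := near_infty_natSinv_lt (PosNum re0).
exists N => n Nn; have := hN n Nn.
by rewrite /= -er -ltcR rmorphV ?unitfE ?pnatr_eq0//= rmorph_nat.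
Qed.

Lemma minimizing_seq (M : set H) z : M !=set0 -> exists u : nat -> H,
  forall n, M (u n) /\
    forall a, M a -> `|z - u n| ^+ 2 <= `|z - a| ^+ 2 + n.+1%:R^-1.
Proof.
move=> [a0 Ma0].
(* Norms take values in [R[i]]; the infimum is taken in [R], through real parts. *)
pose f a : R := complex.Re (`|z - a| ^+ 2).
have fE a : (f a)%:C = `|z - a| ^+ 2.
  by rewrite RRe_real// realX// normr_real.
have Ei : has_inf (f @` M).
  split; first by exists (f a0); exists a0.
  by exists 0 => _ [a _ <-]; rewrite -lecR fE exprn_ge0.
suff h n : exists a, M a /\
    forall b, M b -> `|z - a| ^+ 2 <= `|z - b| ^+ 2 + n.+1%:R^-1.
  by have [u hu] := choice h; exists u.
have n0 : 0 < n.+1%:R^-1 :> R by rewrite invr_gt0.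
have [_ [a Ma <-] ha] := inf_adherent n0 Ei.
exists a; split => // b Mb; rewrite -!fE.
rewrite -(rmorph_nat (real_complex R)) -fmorphV -rmorphD lecR.
apply: (le_trans (ltW ha)); rewrite lerD2r.
by apply: ge_inf; [exact: Ei.2|exists b].
Qed.

Lemma minimizing_seq_dist (M : set H) z (u : nat -> H) :
  (forall a b, M a -> M b -> M (2^-1 *: (a + b))) ->
  (forall n, M (u n) /\
    forall a, M a -> `|z - u n| ^+ 2 <= `|z - a| ^+ 2 + n.+1%:R^-1) ->
  forall n m, `|u n - u m| ^+ 2 <= 2 * (n.+1%:R^-1 + m.+1%:R^-1).
Proof.
move=> mid uM n m; set c := 2^-1 *: (u n + u m).
have Mc : M c by apply: mid; [case: (uM n)|case: (uM m)].
have := parallelogram (z - u m) (z - u n).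
rewrite (_ : z - u m - (z - u n) = u n - u m); last first.
  by rewrite opprB addrC addrA subrK.
rewrite (_ : z - u m + (z - u n) = 2 *: (z - c)); last first.
  rewrite scalerBr scalerA divff ?pnatr_eq0// scale1r scaler_nat mulr2n opprD.
  by rewrite addrACA [- u m + _]addrC.
rewrite normrZ exprMn normr_nat.
move=> /(canRL (addKr _)) ->; rewrite addrC lerBlDr.
have := lerD ((uM n).2 _ Mc) ((uM m).2 _ Mc).
rewrite -(ler_pM2l (_ : 0 < 2 :> R[i])) ?ltr0n// => h.
rewrite [X in 2 * X <= _]addrC; apply: (le_trans h).
by rewrite le_eqVlt; apply/orP; left; apply/eqP; ring.
Qed.

Lemma minimizing_seq_lim (M : set H) z (u : nat -> H) l :
  (forall n, M (u n) /\
    forall a, M a -> `|z - u n| ^+ 2 <= `|z - a| ^+ 2 + n.+1%:R^-1) ->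
  (forall e : R[i], 0 < e -> exists N, forall n, (N <= n)%N -> `|l - u n| < e) ->
  forall a, M a -> `|z - l| <= `|z - a|.
Proof.
move=> uM ul a Ma; rewrite real_leNgt ?normr_real//; apply/negP => lt.
set s := `|z - l| in lt; set t := `|z - a| in lt.
have t0 : 0 <= t by exact: normr_ge0.
(* Half the gap goes to the distance from [z] to [u n], half to that from [u n] to [l]; together
   they give [s < s]. *)
have d0 : 0 < (s - t) / 2 by rewrite divr_gt0 ?subr_gt0 ?ltr0n.
have e0 : 0 < (t + (s - t) / 2) ^+ 2 - t ^+ 2.
  rewrite subr_gt0 ltr_pXn2r ?nnegrE ?ltrDl//.
  by rewrite addr_ge0// ltW.
have [N1 h1] := natSinv_lt _ e0.
have [N2 h2] := ul _ d0.
pose n := maxn N1 N2.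
have /h1 {}h1 : (N1 <= n)%N by exact: leq_maxl.
have /h2 {}h2 : (N2 <= n)%N by exact: leq_maxr.
have : `|z - u n| ^+ 2 < (t + (s - t) / 2) ^+ 2.
  by apply: (le_lt_trans ((uM n).2 _ Ma)); rewrite -ltrBrDl.
rewrite ltr_pXn2r ?nnegrE//; last by rewrite addr_ge0// ltW.
rewrite -(ltrD2r ((s - t) / 2)) (_ : t + _ + _ = s); last by field.
move=> h; have : s < s; last by rewrite ltxx.
apply: le_lt_trans h; rewrite {1}/s.
have -> : z - l = z - u n - (l - u n) by rewrite opprB addrA subrK.
by apply: (le_trans (ler_normB _ _)); rewrite lerD2l ltW.
Qed.

Lemma sqr_dist_cauchy (u : nat -> H) :
  (forall n m, `|u n - u m| ^+ 2 <= 2 * (n.+1%:R^-1 + m.+1%:R^-1)) ->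
  forall e : R[i], 0 < e -> exists N, forall n m, (N <= n)%N -> (N <= m)%N ->
     `|u n - u m| < e.
Proof.
move=> h e e0; have e40 : 0 < e ^+ 2 / 4 by rewrite divr_gt0 ?exprn_gt0 ?ltr0n.
have [N hN] := natSinv_lt _ e40; exists N => n m /hN hn /hN hm.
rewrite -(ltr_pXn2r (isT : (0 < 2)%N)) ?nnegrE//; last exact: ltW.
apply: (le_lt_trans (h n m)).
have -> : e ^+ 2 = 2 * (e ^+ 2 / 4 + e ^+ 2 / 4) by field.
by rewrite ltr_pM2l ?ltr0n// ltrD.
Qed.

End InnerProduct.

(** * Adjoints and unitarity *)

Section Unitary.
Context {R : realType} {H : hilbertType R}.
Implicit Types (x y z : H) (U V W : H -> H).

Local Notation "''[' x , y ]" := (@inner R H x y).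

(* The equations defining [unitary] do not by themselves exclude that [get]
   returns its default value at some y.  As [adjoint U] is injective, this
   happens for at most one y, but if it happens for y it also does for y / 2. *)
Lemma unitary_adjoint {U} x y : unitary U -> '[U x, y] = '[x, adjoint U y].
Proof.
move=> [_ _ _ UU]; have UK v : U (adjoint U v) = v by exact: (congr1 (@^~ v) UU).
pose good y := exists z, forall x, '[U x, y] = '[x, z].
suff gy : good y by have := getPex gy; apply.
apply: contrapT => bad.
have adjE v : ~ good v -> adjoint U v = point.
  by move=> gv; apply: getPN => z hz; apply: gv; exists z.
have bad2 : ~ good (2^-1 *: y).
  move=> [z hz]; apply: bad; exists (2 *: z) => v.
  rewrite innerZr -hz innerZr mulrA -rmorphM divff ?pnatr_eq0//.
  by rewrite rmorph1 mul1r.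
have y2 : y = 2^-1 *: y by rewrite -[LHS]UK (adjE _ bad) -(adjE _ bad2) UK.
apply: bad; have -> : y = 0; last by exists 0 => v; rewrite !inner0r.
have : 2 *: y - y = 0.
  by rewrite {1}y2 scalerA divff ?pnatr_eq0// scale1r subrr.
by rewrite scaler_nat mulr2n addrK.
Qed.

Lemma adjoint_eq {V W} : (forall x y, '[V x, y] = '[x, W y]) -> adjoint V = W.
Proof.
move=> VW; apply/funext => y; apply: get_unique => [x|z hz]; first exact: VW.
by apply: inner_inj => x; rewrite -hz VW.
Qed.

Lemma unitary_inverse {V W} : linear V -> cancel V W -> cancel W V ->
  (forall x y, '[V x, y] = '[x, W y]) -> unitary V.
Proof.
move=> Vl VK WK VW; rewrite /unitary (adjoint_eq VW); split => //.
(* Continuity holds because [V] is isometric: ['[V x, V x] = '[x, W (V x)] = '[x, x]]. *)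
- move=> x; apply/cvgrPdist_lt => e e0; near=> y.
  have -> : V x - V y = V (x - y).
    by rewrite [x - y]addrC -[- y]scaleN1r Vl scaleN1r addrC.
  rewrite (_ : `|V _| = `|x - y|).
    by near: y; apply: cvgr_dist_lt.
  apply/eqP; rewrite -(eqrXn2 (isT : (0 < 2)%N))// !sqr_norm_inner VW VK.
  by [].
- exact/funext.
- exact/funext.
Unshelve. all: by end_near.
Qed.

End Unitary.

(** * Construction of a conjugation intertwining [U] and its adjoint *)

Section ConjugationGraph.
Context {R : realType} {H : hilbertType R} (U Us : H -> H)
  (UUs : forall x y : H, inner (U x) y = inner x (Us y))
  (UK : cancel U Us) (UsK : cancel Us U).
Implicit Types (x y z : H) (G : set (H * H)).

Local Notation "''[' x , y ]" := (@inner R H x y).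

Let UsU x y : '[Us x, y] = '[x, U y].
Proof. by rewrite innerC -UUs -innerC. Qed.

Let UN x : `|U x| = `|x|.
Proof.
by apply/eqP; rewrite -(eqrXn2 (isT : (0 < 2)%N))// !sqr_norm_inner UUs UK.
Qed.

Let UsN x : `|Us x| = `|x|.
Proof. by rewrite -[in RHS](UsK x) UN. Qed.

Let UP k x y : U (k *: x + y) = k *: U x + U y.
Proof.
apply: inner_inj => z.
by rewrite innerDr innerZr -!UsU innerDr innerZr.
Qed.

Let UsP k x y : Us (k *: x + y) = k *: Us x + Us y.
Proof.
apply: inner_inj => z.
by rewrite innerDr innerZr -!UUs innerDr innerZr.
Qed.

Let UB x y : U (x - y) = U x - U y.
Proof. by rewrite [x - y]addrC -[- y]scaleN1r UP scaleN1r addrC. Qed.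

Let UsB x y : Us (x - y) = Us x - Us y.
Proof. by rewrite [x - y]addrC -[- y]scaleN1r UsP scaleN1r addrC. Qed.

(* Graphs of partially defined conjugations J such that J U = U^* J. *)
Definition conj_graph G : Prop :=
  [/\ forall p q, G p -> G q -> '[p.1, q.1] = '[q.2, p.2],
      forall p, G p -> G (p.2, p.1) &
      forall p, G p -> G (U p.1, Us p.2)].

Lemma conj_graph_adj G p : conj_graph G -> G p -> G (Us p.1, U p.2).
Proof. by move=> [_ swp stp] /swp/stp/swp. Qed.

Lemma conj_graph_comb G : conj_graph G ->
  conj_graph [set r | exists k p q, [/\ G p, G q &
    r = (k *: p.1 + q.1, Num.conj k *: p.2 + q.2)]].
Proof.
move=> [iso swp stp]; split.
- move=> _ _ [k [p [q [Gp Gq ->]]]] [k' [p' [q' [Gp' Gq' ->]]]] /=.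
  rewrite !(innerDl, innerDr, innerZl, innerZr) !conjCK.
  rewrite (iso p p')// (iso p q')// (iso q p')// (iso q q')//; ring.
- move=> _ [k [p [q [Gp Gq ->]]]] /=.
  exists (Num.conj k), (p.2, p.1), (q.2, q.1).
  by split; [exact: swp|exact: swp|rewrite conjCK].
- move=> _ [k [p [q [Gp Gq ->]]]] /=.
  exists k, (U p.1, Us p.2), (U q.1, Us q.2).
  by split; [exact: stp|exact: stp|rewrite UP UsP].
Qed.

Lemma conj_graph_closure G : conj_graph G ->
  conj_graph [set r | forall e : R[i], 0 < e ->
    exists p, [/\ G p, `|r.1 - p.1| < e & `|r.2 - p.2| < e]].
Proof.
move=> [iso swp stp]; split.
(* Two limit points are compared by approximating one at a time: [half] treats a limit point against
   a point of [G]. *)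
- have half r p : (forall e : R[i], 0 < e ->
      exists p, [/\ G p, `|r.1 - p.1| < e & `|r.2 - p.2| < e]) -> G p ->
      '[r.1, p.1] = '[p.2, r.2].
    move=> hr Gp; apply: inner_approx => e /hr[q [Gq q1 q2]].
    by exists q.1, q.2; split => //; exact: iso.
  move=> r s hr hs; apply: inner_approx => e /hr[p [Gp p1 p2]].
  exists p.1, p.2; split => //.
  by rewrite innerC (half _ _ hs Gp) -innerC.
- by move=> r hr e /hr[p [/swp Gp p1 p2]]; exists (p.2, p.1).
- move=> r hr e /hr[p [/stp Gp p1 p2]]; exists (U p.1, Us p.2).
  by rewrite /= -UB -UsB UN UsN.
Qed.

Lemma iter_adj n x y : '[iter n U x, y] = '[x, iter n Us y].
Proof. by elim: n x y => // n IH x y; rewrite iterS UUs IH -iterSr. Qed.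

Lemma iter_adj' n x y : '[iter n Us x, y] = '[x, iter n U y].
Proof. by rewrite innerC -iter_adj -innerC. Qed.

Lemma iter_commute n m x : iter n U (iter m Us x) = iter m Us (iter n U x).
Proof.
elim: n x => // n IH x; rewrite iterS IH [in RHS]iterS.
elim: m (iter n U x) {IH} => // m IHm y.
by rewrite !iterS -IHm UK UsK.
Qed.

(** The pair [n], [m] encodes the integer exponent n - m. The domain of [G] is stable under [U] and
    [Us], so the whole orbit of [w] is orthogonal to it and the mixed inner products vanish. *)
Lemma conj_graph_orbit G w : conj_graph G -> (forall p, G p -> '[p.1, w] = 0) ->
  conj_graph (G `|` [set r | exists n m,
    r = (iter n U (iter m Us w), iter n Us (iter m U w))]).
Proof.
move=> cG Gw; have [iso swp stp] := cG.
have orthU v : (forall p, G p -> '[p.1, v] = 0) ->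
    forall p, G p -> '[p.1, U v] = 0.
  by move=> hv p Gp; rewrite -UsU (hv _ (conj_graph_adj _ _ cG Gp)).
have orthUs v : (forall p, G p -> '[p.1, v] = 0) ->
    forall p, G p -> '[p.1, Us v] = 0.
  by move=> hv p Gp; rewrite -UUs (hv _ (stp _ Gp)).
have orth1 n m p : G p -> '[p.1, iter n U (iter m Us w)] = 0.
  elim: n p => [|n IH]; last exact: orthU.
  by elim: m => [//|m IHm]; exact: orthUs.
have orth2 n m p : G p -> '[p.2, iter n Us (iter m U w)] = 0.
  by rewrite -iter_commute => /swp/(orth1 m n).
split.
- move=> p q [Gp|[n [m ->]]] [Gq|[n' [m' ->]]] /=.
  + exact: iso.
  + by rewrite orth1// innerC orth2// rmorph0.
  + by rewrite innerC orth1// orth2// rmorph0.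
  (* Moving the powers of [Us] across turns both sides into
     ['[iter (n + m') U w, iter (n' + m) U w]]. *)
  + rewrite (iter_commute n' m') -iter_adj -[X in '[X, _]]iterD iter_commute.
    rewrite iter_adj' -[in RHS]iter_adj iter_commute iter_adj' -!iterD.
    by rewrite (addnC m') (addnC m).
- move=> p [Gp|[n [m ->]]]; first by left; exact: swp.
  by right; exists m, n; rewrite /= -!iter_commute.
- move=> p [Gp|[n [m ->]]]; first by left; exact: stp.
  by right; exists n.+1, m.
Qed.

(** Each condition involves at most two pairs, and these lie in a common member of the chain. *)
Lemma conj_graph_bigcup (F : set (set (H * H))) :
  (F `<=` conj_graph) -> total_on F subset -> conj_graph (\bigcup_(G in F) G).
Proof.
move=> FG tot; split.
- move=> p q [X FX Xp] [Y FY Yq].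
  have [XY|YX] := tot _ _ FX FY.
  + by have [iso _ _] := FG _ FY; apply: iso => //; exact: XY.
  + by have [iso _ _] := FG _ FX; apply: iso => //; exact: YX.
- by move=> p [X FX Xp]; exists X => //; have [_ swp _] := FG _ FX; exact: swp.
- by move=> p [X FX Xp]; exists X => //; have [_ _ stp] := FG _ FX; exact: stp.
Qed.

Lemma total_conj_graph : exists G, [/\ conj_graph G,
  forall k p q, G p -> G q -> G (k *: p.1 + q.1, Num.conj k *: p.2 + q.2) &
  forall x, exists y, G (x, y)].
Proof.
have [G [cG maxG]] := Zorn_bigcup conj_graph_bigcup.
have maxE G' : conj_graph G' -> G `<=` G' -> G' `<=` G.
  move=> cG' GG'; apply: contrapT => G'G; apply: (maxG G' _ cG').
  by split.
have [iso swp stp] := cG.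
have combG k p q : G p -> G q ->
    G (k *: p.1 + q.1, Num.conj k *: p.2 + q.2).
  move=> Gp Gq; apply: (maxE _ (conj_graph_comb _ cG)); last by exists k, p, q.
  move=> r Gr; exists 0, r, r; split => //.
  by rewrite rmorph0 !scale0r !add0r -surjective_pairing.
have orthG w : (forall p, G p -> '[p.1, w] = 0) -> G (w, w).
  move=> hw; apply: (maxE _ (conj_graph_orbit _ _ cG hw)); first by move=> r; left.
  by right; exists 0, 0.
exists G; split => // z.
have G0 : G (0, 0) by apply: orthG => p _; rewrite inner0r.
pose M := [set x | exists y, G (x, y)].
have combM k a b : M a -> M b -> M (k *: a + b).
  by move=> [a' Ga] [b' Gb]; exists (Num.conj k *: a' + b'); exact: (combG k _ _ Ga Gb).
have M0 : M 0 by exists 0.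
have midM a b : M a -> M b -> M (2^-1 *: (a + b)).
  move=> Ma Mb; rewrite -[_ *: _]addr0; apply: (combM _ _ _ _ M0).
  by rewrite -[a]scale1r; exact: combM.
have [u uM] := minimizing_seq _ z (ex_intro M 0 M0).
have [v Guv] := choice (fun n => (uM n).1).
have ud := minimizing_seq_dist _ _ _ midM uM.
(* The difference of two pairs is again in [G], and pairs in [G] have components of equal norm, so
   [v] inherits the Cauchy bound of [u]. *)
have vd n m : `|v n - v m| ^+ 2 <= 2 * (n.+1%:R^-1 + m.+1%:R^-1).
  have := ud n m; rewrite !sqr_norm_inner.
  have := combG (-1) _ _ (Guv m) (Guv n).
  rewrite rmorphN1 /= !scaleN1r ![- _ + _]addrC => Gd.
  by rewrite (iso _ _ Gd Gd).
have [l ul] := cauchy_seq_lim _ (sqr_dist_cauchy _ ud).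
have [l' vl] := cauchy_seq_lim _ (sqr_dist_cauchy _ vd).
have Gl : G (l, l').
  apply: (maxE _ (conj_graph_closure _ cG)) => [r Gr e e0|e e0].
    by exists r; rewrite !subrr !normr0.
  have [N1 h1] := ul _ e0; have [N2 h2] := vl _ e0.
  exists (u (maxn N1 N2), v (maxn N1 N2)).
  by split => //=; [exact/h1/leq_maxl|exact/h2/leq_maxr].
(* As [l] is a nearest point of the domain [M] to [z], the residual [z - l] is orthogonal to [M],
   and [orthG] applies. *)
have Gw : G (z - l, z - l).
  apply: orthG => -[a a'] Ga /=; rewrite innerC orthogonal_minimal ?rmorph0// => k.
  rewrite -addrA -opprD; apply: (minimizing_seq_lim _ _ _ _ uM ul).
  by rewrite addrC; apply: combM; [exists a'|exists l'].
by exists (z - l + l'); have := combG 1 _ _ Gw Gl; rewrite /= rmorph1 !scale1r subrK.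
Qed.

Lemma exists_conjugation_intertwining : exists J : H -> H, [/\ antilinear J,
  forall x y, '[J x, J y] = '[y, x], cancel J J & forall x, J (U x) = Us (J x)].
Proof.
have [G [[iso swp stp] comb tot]] := total_conj_graph.
have [J GJ] := choice tot.
(* [G] is single-valued: subtracting two pairs over [x] leaves a pair with first component 0, whose
   second component then has norm 0. *)
have fun_graph x y : G (x, y) -> J x = y.
  move=> Gxy; have := comb (-1) _ _ Gxy (GJ x).
  rewrite /= rmorphN1 !scaleN1r addNr => G0.
  have /= := iso _ _ G0 G0; rewrite inner0r => /esym/eqP.
  by rewrite dnorm_eq0 addrC subr_eq0 => /eqP.
exists J; split.
- by move=> k x y; apply: fun_graph; exact: (comb k _ _ (GJ x) (GJ y)).
- by move=> x y; rewrite -(iso _ _ (GJ y) (GJ x)).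
- by move=> x; apply: fun_graph; exact: (swp _ (GJ x)).
- by move=> x; apply: fun_graph; exact: (stp _ (GJ x)).
Qed.

End ConjugationGraph.

Theorem corollary2p6 (R : realType) (H : hilbertType R) (sepH : separable H)
    (U : H -> H) (unitU : unitary U) :
  conjugate_orbit U `<=` unitary_orbit (adjoint U).
Proof.
have [_ _ UK UsK] := unitU.
have [J [Jl Ji JK JU]] := exists_conjugation_intertwining U (adjoint U)
  (fun x y => unitary_adjoint x y unitU)
  (fun x => congr1 (@^~ x) UK) (fun x => congr1 (@^~ x) UsK).
move=> _ [C cC <-]; have [Cl _ CC] := cC.
have CK x : C (C x) = x by exact: (congr1 (@^~ x) CC).
(* Each of [C] and [J] is an involution that swaps the slots of the inner product; two swaps restore
   the order. *)
have VW x y : inner ((C \o J) x) y = inner x ((J \o C) y).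
  by rewrite /= -[y in LHS]CK (conjugation_inner _ _ _ cC) -[C y in LHS]JK Ji.
exists (C \o J).
  apply: (unitary_inverse _ _ _ VW).
  - by move=> k x y; rewrite /= Jl /= Cl /= conjCK.
  - by move=> x; rewrite /= CK JK.
  - by move=> x; rewrite /= JK CK.
rewrite (adjoint_eq VW); apply/funext => x /=.
by rewrite -JU JK.
Qed.
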